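(* Let $G$ be a graph. Then $G$ is not weakly critical if and only if there exist induced subgraphs $M_1\subseteq M_2\subseteq G$ such that (1) $|V_{M_2\setminus M_1}|=2$, (2) $\Psi(M_1)=\Psi(M_2)$, (3) $\Psi(G)=\Psi(M_2)+\left\lfloor \frac{|V_{G\setminus M_2}|}{2}\right\rfloor$. Moreover, for such $M_1\subseteq M_2$, if $\ell$ is a maximal pseudocomplete coloring of $G$, then there exists $C\subseteq V_G$ with $|C|=\left\lfloor\frac{|V_{G\setminus M_1}|}{2}\right\rfloor+1\ge 2$ and $\ell(G)=\ell(G\setminus C)$.
   Context: All graphs are finite and simple; $V_G$ is the vertex set of $G$ and $|G|$ its number of vertices. For an induced subgraph (or vertex set) $M$ of $G$, $G\setminus M$ is the subgraph of $G$ induced on the vertices not in $M$. A coloring of a graph $G=(V,E)$ is a surjective map $\ell$ from $V$ onto a finite set of colors; it need not be proper. It is pseudocomplete if for any two distinct colors $i,j$ used there is an edge $uv\in E$ with $\{\ell(u),\ell(v)\}=\{i,j\}$. The pseudoachromatic number $\Psi(G)$ is the greatest number of colors used in a pseudocomplete coloring of $G$ (so $\Psi$ of the graph with no vertices is $0$). A maximal pseudocomplete coloring of $G$ is a pseudocomplete coloring using $\Psi(G)$ colors. $\ell(G)$ and $\ell(G\setminus C)$ denote the sets of colors appearing on the vertices of $G$ and of $G\setminus C$. For an integer $0\le k\le |G|$, $\operatorname{mpd}_G(k)=\min\{\Psi(G)-\Psi(G\setminus X) : X\subseteq V_G,\ |X|=k\}$. $G$ is weakly critical if $\operatorname{mpd}_G(k)\ge\lfloor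 k/2\rfloor$ for all $0\le k\le |G|$. *)

(* Defs.v *)
From mathcomp Require Import all_boot.

Set Implicit Arguments.
Unset Strict Implicit.
Unset Printing Implicit Defensive.

Record sgraph := SGraph {
  vertex :> finType;
  edge : rel vertex;
  edge_sym : symmetric edge;
  edge_irrefl : irreflexive edge
}.

Section Induced.
Variables (G : sgraph) (S : {set G}).

Definition induced_edge : rel {x : G | x \in S} :=
  fun u v => edge (val u) (val v).

Lemma induced_edge_sym : symmetric induced_edge.
Proof. by move=> u v; apply: edge_sym. Qed.

Lemma induced_edge_irrefl : irreflexive induced_edge.
Proof. by move=> u; apply: edge_irrefl. Qed.

Definition induced : sgraph := SGraph induced_edge_sym induced_edge_irrefl.

End Induced.

Section Colorings.
Variables (G : sgraph) (K : finType).
Implicit Type l : G -> K.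

Definition coloring l : bool := [forall c : K, exists v : G, l v == c].

Definition pseudocomplete l : bool :=
  [forall i : K, forall j : K, (i != j) ==>
    [exists u : G, exists v : G,
       edge u v && ([set l u; l v] == [set i; j])]].

End Colorings.

(* A surjective coloring uses at most #|G| colors, so bounding k loses nothing;
   see PsiP for colorings with an arbitrary finite set of colors. *)
Definition Psi (G : sgraph) : nat :=
  \max_(k < #|G|.+1 |
        [exists l : {ffun G -> 'I_k}, coloring l && pseudocomplete l]) k.

Definition maximal_pseudocomplete (G : sgraph) (K : finType) (l : G -> K) :=
  [/\ coloring l, pseudocomplete l & #|K| = Psi G].

(* Psi is monotone under induced subgraphs, so the truncated subtraction is the
   true one. The values are at most Psi G, so the neutral element Psi G does not
   affect the minimum when k <= #|G|; for k > #|G| the value is meaningless. *)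
Definition mpd (G : sgraph) (k : nat) : nat :=
  \big[minn/Psi G]_(X : {set G} | #|X| == k) (Psi G - Psi (induced (~: X))).

Definition weakly_critical (G : sgraph) : Prop :=
  forall k : nat, k <= #|G| -> k./2 <= mpd G k.

Lemma coloring_card (G : sgraph) (K : finType) (l : G -> K) :
  coloring l -> #|K| <= #|G|.
Proof.
move=> /forallP sl; rewrite -cardsT -[leqRHS]cardsT.
suff -> : [set: K] = l @: [set: G] by apply: leq_imset_card.
apply/setP=> c; rewrite !inE; have /existsP[v /eqP <-] := sl c.
by rewrite imset_f ?inE.
Qed.

Lemma Psi_ge (G : sgraph) (K : finType) (l : G -> K) :
  coloring l -> pseudocomplete l -> #|K| <= Psi G.
Proof.
move=> sl pl; have := coloring_card sl; rewrite -ltnS => ltK.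
apply: (@leq_bigmax_cond _ _ (fun k : 'I_#|G|.+1 => k : nat) (Ordinal ltK)).
apply/existsP; exists [ffun v => enum_rank (l v)]; apply/andP; split.
  apply/forallP=> c; have /existsP[v /eqP lv] := forallP sl (enum_val c).
  by apply/existsP; exists v; rewrite ffunE lv enum_valK.
apply/forallP=> i; apply/forallP=> j; apply/implyP=> ij.
have /existsP[u /existsP[v /andP[uv /eqP luv]]] :=
  implyP (forallP (forallP pl (enum_val i)) (enum_val j))
    (etrans (congr1 negb (inj_eq enum_val_inj i j)) ij).
apply/existsP; exists u; apply/existsP; exists v; rewrite uv !ffunE /=.
move/(congr1 (fun A : {set K} => enum_rank @: A)): luv.
by rewrite !imsetU !imset_set1 !enum_valK => ->.
Qed.

Lemma Psi_attained (G : sgraph) :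
  exists l : G -> 'I_(Psi G), coloring l && pseudocomplete l.
Proof.
pose P (k : 'I_#|G|.+1) :=
  [exists l : {ffun G -> 'I_k}, coloring l && pseudocomplete l].
have [G0|Gn0] := posnP #|G|.
  have P0 : Psi G = 0.
    apply/eqP; rewrite -leqn0 /Psi; apply/bigmax_leqP=> k _.
    by rewrite -ltnS -[X in _ < X.+1]G0.
  have noG : G -> False by move=> v; move: (card0_eq G0 v); rewrite !inE.
  exists (fun v => False_rect _ (noG v)).
  have noK : 'I_(Psi G) -> False by rewrite P0; case.
  by apply/andP; split; apply/forallP=> c; case: (noK c).
have /card_gt0P[v0 _] := Gn0.
have P1 : P (inord 1).
  rewrite /P inordK //; apply/existsP; exists [ffun=> ord0]; apply/andP; split.
    by apply/forallP=> c; apply/existsP; exists v0; rewrite ffunE [c]ord1.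
  apply/forallP=> i; apply/forallP=> j.
  by rewrite [i]ord1 [j]ord1 eqxx.
have := @bigmax_eq_arg _ (inord 1) P (fun k => k : nat) P1.
case: arg_maxnP => // k /existsP[l lP] _ Pk.
by rewrite /Psi Pk; exists l.
Qed.

Lemma PsiP (G : sgraph) (n : nat) :
  n = Psi G <->
  (exists (K : finType) (l : G -> K),
     [/\ coloring l, pseudocomplete l & #|K| = n]) /\
  (forall (K : finType) (l : G -> K),
     coloring l -> pseudocomplete l -> #|K| <= n).
Proof.
have [l /andP[sl pl]] := Psi_attained G; split=> [->|[[K [l' [sl' pl' <-]]] mx]].
  split; last exact: Psi_ge.
  by exists 'I_(Psi G), l; rewrite card_ord.
apply/eqP; rewrite eqn_leq (Psi_ge sl' pl') /=.
by rewrite -[X in X <= _]card_ord (mx _ l).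
Qed.

(* Main.v *)
Require Import Defs.
From mathcomp Require Import all_boot all_order.

(** Write Psi(S) for the pseudoachromatic number of the subgraph induced on S.

    Since Psi is monotone under taking subgraphs ([leq_Psi_induced]), adding two
    vertices back to a set never decreases it.  If G is not weakly critical,
    take a smallest set X such that Psi(G) - Psi(~: X) < floor(|X| / 2).  It has
    at least two vertices.  Put M1 = ~: X and add any two vertices of X to get
    M2, with complement Y.  Writing m = floor(|Y| / 2), so that floor(|X| / 2) =
    m + 1, the choice of X gives Psi(M1) >= Psi(G) - m, while its minimality
    gives Psi(M2) <= Psi(G) - m.  As Psi(M1) <= Psi(M2), all of these are equal.
    Conversely, for a pair M1, M2 as in the theorem, the complement of M1
    violates weak criticality, because it has two more vertices than that of M2
    while Psi does not drop any further.

    The last assertion is a count.  A set C can be removed without losing a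
    color as soon as it avoids one chosen vertex of each color, so every size up
    to |G| - Psi(G) is available ([removable_set]).  With k = |G \ M1|, the
    conditions give Psi(G) = Psi(M1) + floor(k/2) - 1 <= (|G| - k) + floor(k/2) - 1,
    which leaves at least floor(k/2) + 1 spare vertices. *)

Set Implicit Arguments.
Unset Strict Implicit.
Unset Printing Implicit Defensive.

Lemma subset_of_card (T : finType) (A : {set T}) n :
  n <= #|A| -> exists2 B : {set T}, B \subset A & #|B| = n.
Proof.
case/card_geqP=> s [us <- sA]; exists [set x in s].
  by apply/subsetP=> x; rewrite inE; apply: sA.
by rewrite cardsE; apply/card_uniqP.
Qed.

Lemma Psi_leq_card (G : sgraph) : Psi G <= #|G|.
Proof.
have [l /andP[sl _]] := Psi_attained G.
by have := coloring_card sl; rewrite card_ord.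
Qed.

Lemma Psi_induced_leq_card (G : sgraph) (S : {set G}) :
  Psi (induced S) <= #|S|.
Proof. by have := Psi_leq_card (induced S); rewrite card_sig. Qed.

(** A pseudocomplete coloring of H is transported along the embedding; the
    vertices outside the image can take an arbitrary color, because more
    vertices and edges cannot spoil pseudocompleteness. *)
Lemma leq_Psi_embedding (H G : sgraph) (h : H -> G) :
  injective h -> (forall u v, edge u v -> edge (h u) (h v)) -> Psi H <= Psi G.
Proof.
move=> injh homh; have [l /andP[/forallP sl /forallP pl]] := Psi_attained H.
have [->//|/prednK Psi_gt0] := posnP (Psi H).
pose c0 := cast_ord Psi_gt0 ord0.
pose l' (x : G) := if [pick v | h v == x] is Some v then l v else c0.
have l'h v : l' (h v) = l v.
  rewrite /l'; case: pickP => [w /eqP/injh -> // | /(_ v)].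
  by rewrite eqxx.
rewrite -[leqLHS]card_ord; apply: (@Psi_ge G _ l').
  apply/forallP=> c; have /existsP[v /eqP <-] := sl c.
  by apply/existsP; exists (h v); rewrite l'h.
apply/forallP=> i; apply/forallP=> j; apply/implyP=> ij.
have /existsP[u /existsP[v /andP[uv luv]]] := implyP (forallP (pl i) j) ij.
by apply/existsP; exists (h u); apply/existsP; exists (h v); rewrite homh ?l'h.
Qed.

Lemma leq_Psi_induced (G : sgraph) (S T : {set G}) :
  S \subset T -> Psi (induced S) <= Psi (induced T).
Proof.
move=> /subsetP ST.
pose h (u : induced S) : induced T := Sub (val u) (ST _ (valP u)).
apply: (@leq_Psi_embedding _ _ h) => // u v /(congr1 val) /= uv.
exact: val_inj.
Qed.

Lemma Psi_induced_leq (G : sgraph) (S : {set G}) : Psi (induced S) <= Psi G.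
Proof.
by apply: (@leq_Psi_embedding _ _ (fun u : induced S => val u)) => //;
   apply: val_inj.
Qed.

(** The bound on k provides a set of size k, which makes the neutral element of
    the iterated minimum irrelevant. *)
Lemma leq_mpdP (G : sgraph) k m : k <= #|G| ->
  reflect (forall X : {set G}, #|X| = k -> m <= Psi G - Psi (induced (~: X)))
          (m <= mpd G k).
Proof.
move=> kG; rewrite /mpd -minEnat -leEnat.
apply: (iffP (Order.TotalTheory.bigmin_geP _ _ _ _)); rewrite leEnat.
  by move=> [_ mX] X /eqP Xk; apply: mX.
move: kG; rewrite -cardsT => /subset_of_card[X0 _ X0k] mX.
by split=> [|X /eqP]; [apply: leq_trans (mX _ X0k) (leq_subr _ _) | apply: mX].
Qed.

(** Weak criticality is violated by individual sets; speaking of them instead of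
    the minimum over all sets of a given size allows a smallest violation to be
    chosen directly, without reference to [mpd]. *)
Definition cheap (G : sgraph) (X : {set G}) :=
  Psi G - Psi (induced (~: X)) < #|X|./2.

Lemma weakly_criticalP (G : sgraph) :
  reflect (weakly_critical G) [forall X : {set G}, ~~ cheap X].
Proof.
apply: (iffP forallP) => [ncheap k kG|wG X].
  by apply/leq_mpdP=> // X <-; rewrite leqNgt; apply: ncheap.
by rewrite -leqNgt; have/(leq_mpdP _ (max_card _)) := wG _ (max_card X); apply.
Qed.

(** One vertex of each color is kept, and C is chosen among the others. *)
Lemma removable_set (G : sgraph) (K : finType) (l : G -> K) n :
  coloring l -> n + #|K| <= #|G| ->
  exists2 C : {set G}, #|C| = n & l @: [set: G] = l @: (~: C).
Proof.
move=> /forallP sl leG.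
have colP c : exists v, l v == c by apply/existsP; apply: sl.
pose T := [set xchoose (colP c) | c in K].
have : n <= #|~: T|.
  rewrite -(leq_add2r #|T|) [leqRHS]addnC cardsC.
  by apply: leq_trans leG; rewrite leq_add2l leq_imset_card.
case/subset_of_card=> C CT <-; exists C => //.
apply/eqP; rewrite eqEsubset [X in _ && X]imsetS ?subsetT // andbT.
apply/subsetP=> c _; rewrite -(eqP (xchooseP (colP c))) imset_f //.
rewrite inE; apply/negP=> /(subsetP CT); rewrite inE => /negP; apply.
exact: imset_f.
Qed.

Lemma card_setC_add2 (T : finType) (A B : {set T}) :
  A \subset B -> #|B :\: A| = 2 -> #|~: A| = #|~: B|.+2.
Proof.
move=> AB AB2; rewrite -(cardsID B (~: A)) setIC -setDE AB2 setDE.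
by have /setIidPr -> : ~: B \subset ~: A by rewrite setCS.
Qed.

Theorem theorem4p5 (G : sgraph) :
  let good (M1 M2 : {set G}) :=
    [/\ M1 \subset M2,
        #|M2 :\: M1| = 2,
        Psi (induced M1) = Psi (induced M2)
      & Psi G = Psi (induced M2) + #|~: M2|./2] in
  (~ weakly_critical G <-> exists M1 M2 : {set G}, good M1 M2) /\
  (forall M1 M2 : {set G}, good M1 M2 ->
     forall (K : finType) (l : G -> K), maximal_pseudocomplete l ->
       exists C : {set G},
         [/\ #|C| = #|~: M1|./2.+1,
             2 <= #|~: M1|./2.+1
           & l @: [set: G] = l @: (~: C)]).
Proof.
move=> good; split; first split.
- move/weakly_criticalP; rewrite negb_forall => /existsP[X0 /negPn cX0].
  case: (arg_minnP (fun X : {set G} => #|X|) cX0) => X cX minX.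
  have X_ge2 : 2 <= #|X|.
    by move: cX; rewrite /cheap; case: #|X| => [|[|]] //=; rewrite ltn0.
  have [P PX P2] := subset_of_card X_ge2.
  have sM : ~: X \subset ~: X :|: P by apply: subsetUl.
  have dM : #|(~: X :|: P) :\: ~: X| = 2.
    by rewrite setDUl setDv set0U setDE setCK (setIidPl PX).
  exists (~: X), (~: X :|: P).
  have := card_setC_add2 sM dM; rewrite setCK.
  set M2 := ~: X :|: P in sM dM * => cardX.
  have : ~~ cheap (~: M2).
    by apply/negP=> /minX; rewrite cardX ltnNge leqnSn.
  move: cX; rewrite /cheap setCK -leqNgt cardX /= ltnS => upper lower.
  have mono := leq_Psi_induced sM; have M2G := Psi_induced_leq M2.
  have eqd : Psi G - Psi (induced M2) = #|~: M2|./2.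
    by apply/eqP; rewrite eqn_leq lower (leq_trans (leq_sub2l _ mono)).
  split=> //; last by rewrite -eqd subnKC.
  by apply/eqP; rewrite eqn_leq mono /= -(leq_sub2lE _ M2G) eqd.
- case=> M1 [M2 [sM dM eqPsi PsiG]] /weakly_criticalP/forallP/(_ (~: M1)).
  by rewrite /cheap setCK (card_setC_add2 sM dM) eqPsi PsiG addKn /= ltnSn.
move=> M1 M2 [sM dM eqPsi PsiG] K l [sl pl cardK].
have cardM1 := card_setC_add2 sM dM.
suff /(removable_set sl)[C cardC lC] : #|~: M1|./2.+1 + #|K| <= #|G|.
  by exists C; split=> //; rewrite cardM1.
rewrite cardK PsiG -eqPsi -(cardsC M1) addnCA.
apply: leq_add (Psi_induced_leq_card M1) _.
by rewrite cardM1 /= !addSn !ltnS addnn -[leqRHS]odd_double_half leq_addl.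
Qed.
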